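(* Let $\mathbf{x}_1,\ldots,\mathbf{x}_r$ ($r\ge 1$) be points of the hyperboloid $\mathcal H$. For $P\in\mathcal H$ let $t_i=d_H(P,\mathbf{x}_i)$ be the hyperbolic distance from $P$ to $\mathbf{x}_i$, and let $\mathbf{v}_i$ be the unit tangent vector at $P$ in the geodesic direction from $P$ to $\mathbf{x}_i$. Then the hyperbolic center of mass $\mathcal C_{\mathcal H}(\mathbf{x}_1,\ldots,\mathbf{x}_r)$ is the unique point $P\in\mathcal H$ that satisfies $$\sum_{i=1}^r (\sinh t_i)\,\mathbf{v}_i=0 .$$
   Context: On $\mathbb R^3$ consider the Minkowski pairing $M(\mathbf{x},\mathbf{y})=-x_1y_1-x_2y_2+x_3y_3$ and $\|\mathbf{x}\|^2=M(\mathbf{x},\mathbf{x})$. The hyperboloid model of the hyperbolic plane is $\mathcal H=\{\mathbf{x}=(x,y,z)\in\mathbb R^3:\ \|\mathbf{x}\|^2=1,\ z>0\}$, with hyperbolic distance given by $\cosh d_H(\mathbf{x},\mathbf{y})=M(\mathbf{x},\mathbf{y})$. The geodesic starting at $P\in\mathcal H$ with unit tangent direction $\mathbf{v}$ (that is, $M(P,\mathbf{v})=0$, $M(\mathbf{v},\mathbf{v})=-1$) is $\mathbf{x}(t)=(\cosh t)P+(\sinh t)\mathbf{v}$, where $t$ is the hyperbolic distance from $P$ to $\mathbf{x}(t)$. Thus $\mathbf{x}_i=(\cosh t_i)P+(\sinh t_i)\mathbf{v}_i$. If $\mathbf{x}_i=P$ then $t_i=0$, $\mathbf v_i$ may be any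 unit tangent vector, and the corresponding term is $0$. The hyperbolic center of mass of $\mathbf{x}_1,\ldots,\mathbf{x}_r\in\mathcal H$ is $$\mathcal C_{\mathcal H}(\mathbf{x}_1,\ldots,\mathbf{x}_r)=\frac{\sum_{j=1}^r\mathbf{x}_j}{\left\|\sum_{j=1}^r\mathbf{x}_j\right\|}\in\mathcal H .$$ *)

(* Defs.v *)
From HB Require Import structures.
From mathcomp Require Import all_boot all_order all_algebra.
From mathcomp Require Import all_classical all_reals all_analysis.
From mathcomp Require Import ring lra.

Set Implicit Arguments.
Unset Strict Implicit.
Unset Printing Implicit Defensive.

Import Order.TTheory GRing.Theory Num.Theory.
Local Open Scope ring_scope.

Section Hyperboloid.
Variable R : realType.
Implicit Types (t u : R) (x y P v w : 'rV[R]_3).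

Definition cosh t : R := (expR t + expR (- t)) / 2.

Definition sinh t : R := (expR t - expR (- t)) / 2.

(* The inverse of cosh : [0, +oo[ -> [1, +oo[; meaningful only for 1 <= u. *)
Definition arcosh u : R := ln (u + Num.sqrt (u ^+ 2 - 1)).

(* Coordinates are numbered from 0, so the positive coordinate is the one of
   index 2. *)
Definition minkowski x y : R :=
  - (x 0 0 * y 0 0) - x 0 1 * y 0 1 + x 0 2 * y 0 2.

(* Used only on vectors x with 0 <= minkowski x x. *)
Definition mnorm x : R := Num.sqrt (minkowski x x).

Definition hyperboloid x : Prop := minkowski x x = 1 /\ 0 < x 0 2.

(* On the hyperboloid this is the nonnegative solution d of
   cosh d = minkowski x y; see cosh_hdist and hdist_ge0. *)
Definition hdist x y : R := arcosh (minkowski x y).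

(* If x = P then hdist P x = 0 and every unit tangent vector at P qualifies. *)
Definition unit_direction P x v : Prop :=
  [/\ minkowski P v = 0, minkowski v v = -1
    & x = cosh (hdist P x) *: P + sinh (hdist P x) *: v].

Definition hyperbolic_center (r : nat) (x : 'I_r -> 'rV[R]_3) : 'rV[R]_3 :=
  (mnorm (\sum_(j < r) x j))^-1 *: \sum_(j < r) x j.

Lemma arcosh_ge0 u : 1 <= u -> 0 <= arcosh u.
Proof.
by move=> u1; apply: ln_ge0; rewrite (le_trans u1)// lerDl sqrtr_ge0.
Qed.

Lemma arcoshK u : 1 <= u -> cosh (arcosh u) = u.
Proof.
move=> u1; rewrite /cosh /arcosh expRN.
have s0 := sqrtr_ge0 (u ^+ 2 - 1).
have /sqr_sqrtr sE : 0 <= u ^+ 2 - 1 by nra.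
rewrite lnK; last by rewrite posrE; lra.
set s := Num.sqrt _ in s0 sE *.
have -> : (u + s)^-1 = u - s.
  by apply: (mulfI (x := u + s)); [lra | rewrite divff; [nra | lra]].
lra.
Qed.

Lemma minkowski_ge1 x y :
  hyperboloid x -> hyperboloid y -> 1 <= minkowski x y.
Proof.
rewrite /hyperboloid /minkowski => -[xx x2] [yy y2].
move: (x 0 0) (x 0 1) (x 0 2) (y 0 0) (y 0 1) (y 0 2) xx x2 yy y2.
move=> a b c d e f cE c0 fE f0.
have h : (1 + a * d + b * e) ^+ 2 <= (c * f) ^+ 2.
  have -> : (c * f) ^+ 2 = (1 + a ^+ 2 + b ^+ 2) * (1 + d ^+ 2 + e ^+ 2).
    by rewrite exprMn; congr (_ * _); nra.
  have := sqr_ge0 (a - d); have := sqr_ge0 (b - e).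
  by have := sqr_ge0 (a * e - b * d); nra.
have : 0 <= c * f by rewrite mulr_ge0 ?ltW.
nra.
Qed.

Lemma hdist_ge0 x y : hyperboloid x -> hyperboloid y -> 0 <= hdist x y.
Proof. by move=> hx hy; exact/arcosh_ge0/minkowski_ge1. Qed.

Lemma cosh_hdist x y :
  hyperboloid x -> hyperboloid y -> cosh (hdist x y) = minkowski x y.
Proof. by move=> hx hy; exact/arcoshK/minkowski_ge1. Qed.

Lemma hdistxx x : hyperboloid x -> hdist x x = 0.
Proof.
by case=> xx _; rewrite /hdist /arcosh xx expr1n subrr sqrtr0 addr0 ln1.
Qed.

Lemma sinh_direction_unique P x v w :
  unit_direction P x v -> unit_direction P x w ->
  sinh (hdist P x) *: v = sinh (hdist P x) *: w.
Proof. by case=> _ _ + [_ _]; move=> {1}-> /addrI. Qed.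

Lemma cosh_sinh t : cosh t ^+ 2 - sinh t ^+ 2 = 1.
Proof.
have e1 : expR t * expR (- t) = 1 by rewrite -expRD subrr expR0.
by rewrite /cosh /sinh; nra.
Qed.

Lemma minkowski_eq1 x y :
  hyperboloid x -> hyperboloid y -> minkowski x y = 1 -> y = x.
Proof.
rewrite /hyperboloid /minkowski => -[xx x2] [yy y2] xy.
have key : (x 0 0 - y 0 0) ^+ 2 + (x 0 1 - y 0 1) ^+ 2
         + (x 0 0 * y 0 1 - x 0 1 * y 0 0) ^+ 2 = 0.
  move: (x 0 0) (x 0 1) (x 0 2) (y 0 0) (y 0 1) (y 0 2) xx yy xy x2 y2.
  move=> a b c d e f cE fE cf _ _.
  have h : (c * f) ^+ 2 = (1 + a ^+ 2 + b ^+ 2) * (1 + d ^+ 2 + e ^+ 2).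
    by rewrite exprMn; congr (_ * _); nra.
  have cfE : c * f = 1 + a * d + b * e by lra.
  by rewrite cfE in h; nra.
move/eqP: key; rewrite paddr_eq0 ?addr_ge0 ?sqr_ge0// paddr_eq0 ?sqr_ge0//.
rewrite !sqrf_eq0 !subr_eq0 => /andP[/andP[/eqP e0 /eqP e1] _].
have e2 : x 0 2 = y 0 2.
  have /eqP : x 0 2 ^+ 2 = y 0 2 ^+ 2 by rewrite e0 e1 in xx; lra.
  by rewrite eqrXn2 ?ltW// => /eqP.
apply/rowP => i.
have [->|->|->] : [\/ i = 0, i = 1 | i = 2] => //.
by case: i => [[|[|[|//]]] ?]; [constructor 1|constructor 2|constructor 3];
  exact/val_inj.
Qed.

Lemma unit_direction_exists P x :
  hyperboloid P -> hyperboloid x -> exists v, unit_direction P x v.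
Proof.
move=> hP hx.
have cE := cosh_hdist hP hx; have csE := cosh_sinh (hdist P x).
have [[PP P2] [xx _]] := (hP, hx).
have [s0|s0] := eqVneq (sinh (hdist P x)) 0.
- have c1 : cosh (hdist P x) = 1.
    by have := minkowski_ge1 hP hx; rewrite -cE; rewrite s0 in csE; nra.
  have xP : x = P by apply: minkowski_eq1 => //; rewrite -cE.
  have q0 : 0 < P 0 2 ^+ 2 - P 0 0 ^+ 2.
    by rewrite /minkowski in PP; have := sqr_ge0 (P 0 1); nra.
  pose q := Num.sqrt (P 0 2 ^+ 2 - P 0 0 ^+ 2).
  have qE : q ^+ 2 = P 0 2 ^+ 2 - P 0 0 ^+ 2 by rewrite sqr_sqrtr ?ltW.
  have qn0 : q != 0 by rewrite gt_eqF// sqrtr_gt0.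
  exists (\row_j [:: P 0 2 / q; 0; P 0 0 / q]`_j).
  split.
  + by rewrite /minkowski !mxE /=; field.
  + rewrite /minkowski !mxE /=.
    apply: (mulfI (expf_neq0 2 qn0)); rewrite [in RHS]qE.
    by field.
  + by rewrite c1 s0 scale1r scale0r addr0.
- rewrite /unit_direction; set c := cosh _ in cE csE *.
  set s := sinh _ in csE s0 *.
  exists (s^-1 *: (x - c *: P)); split.
  + transitivity (s^-1 * (minkowski P x - c * minkowski P P)).
      by rewrite /minkowski !mxE; ring.
    by rewrite PP cE mulr1 subrr mulr0.
  + transitivity (s ^- 2 * (minkowski x x - 2 * c * minkowski P x
                            + c ^+ 2 * minkowski P P)).
      by rewrite /minkowski !mxE; field.
    rewrite xx PP -cE; apply: (mulfI (expf_neq0 2 s0)).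
    by rewrite mulrA divff ?expf_neq0// mul1r; lra.
  + by rewrite scalerA divff// scale1r addrC subrK.
Qed.

End Hyperboloid.

(* Main.v *)
Require Import Defs.
From mathcomp Require Import all_boot all_order all_algebra.
From mathcomp Require Import all_classical all_reals all_analysis.
From mathcomp Require Import ring.

Import Order.TTheory GRing.Theory Num.Theory.
Local Open Scope ring_scope.

(** Let S be the sum of the points.  Summing the geodesic equations
    x_i = (cosh t_i) P + (sinh t_i) v_i, in which cosh t_i = M(P, x_i), gives
      sum_i (sinh t_i) v_i = S - M(P, S) P
    (lemma [sum_sinh_direction]): the sum of the tangent vectors is the
    component of S orthogonal to P.  It vanishes exactly when S is a multiple
    of P.  Since S is future timelike, that is, M(S, S) > 0 and its last
    coordinate is positive ([minkowski_sum_gt0], [coord2_sum_gt0]), the ray it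
    spans meets the hyperboloid in exactly one point, namely S / ||S||, the
    center of mass. *)

(* The bare name otherwise denotes the Minkowski inequality for L^p norms. *)
Local Notation minkowski := Defs.minkowski.

Lemma minkowskiC (R : realType) (x y : 'rV[R]_3) :
  minkowski x y = minkowski y x.
Proof. by rewrite /minkowski; ring. Qed.

Lemma minkowskiZr (R : realType) (a : R) (x y : 'rV[R]_3) :
  minkowski x (a *: y) = a * minkowski x y.
Proof. by rewrite /minkowski !mxE; ring. Qed.

Lemma minkowski_sumr (R : realType) (r : nat) (P : 'rV[R]_3)
    (x : 'I_r -> 'rV[R]_3) :
  minkowski P (\sum_(i < r) x i) = \sum_(i < r) minkowski P (x i).
Proof.
rewrite /minkowski !summxE big_split sumrB sumrN /=.
by rewrite !mulr_sumr.
Qed.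

Lemma sumr_ord_gt0 (R : realType) (r : nat) (f : 'I_r -> R) :
  (1 <= r)%N -> (forall i, 0 < f i) -> 0 < \sum_(i < r) f i.
Proof.
case: r f => // r f _ f0; rewrite big_ord_recl ltr_pwDl//.
by rewrite sumr_ge0// => i _; rewrite ltW.
Qed.

Section SumOfPoints.
Variables (R : realType) (r : nat) (x : 'I_r -> 'rV[R]_3).
Hypotheses (r_gt0 : (1 <= r)%N) (hx : forall i, hyperboloid (x i)).
Let S := \sum_(i < r) x i.

Lemma minkowski_hyperboloid_sum_gt0 (P : 'rV[R]_3) :
  hyperboloid P -> 0 < minkowski P S.
Proof.
move=> hP; rewrite minkowski_sumr sumr_ord_gt0// => i.
by rewrite (lt_le_trans ltr01)// minkowski_ge1.
Qed.

(** Each term of the expansion M(S, S) = sum_i M(S, x_i) is positive, because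
    two points of the hyperboloid always pair to at least 1. *)
Lemma minkowski_sum_gt0 : 0 < minkowski S S.
Proof.
rewrite {2}/S minkowski_sumr sumr_ord_gt0// => i.
by rewrite minkowskiC minkowski_hyperboloid_sum_gt0.
Qed.

Lemma coord2_sum_gt0 : 0 < S 0 2.
Proof. by rewrite summxE sumr_ord_gt0// => i; case: (hx i). Qed.

Lemma mnorm_sum_gt0 : 0 < mnorm S.
Proof. by rewrite sqrtr_gt0 minkowski_sum_gt0. Qed.

Lemma sum_hyperbolic_center : S = mnorm S *: hyperbolic_center x.
Proof.
by rewrite scalerA divff ?scale1r// gt_eqF// mnorm_sum_gt0.
Qed.

Lemma hyperboloid_center : hyperboloid (hyperbolic_center x).
Proof.
have n0 := mnorm_sum_gt0; split; last first.
  by rewrite mxE mulr_gt0 ?invr_gt0// coord2_sum_gt0.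
rewrite /hyperbolic_center minkowskiZr minkowskiC minkowskiZr.
have -> : minkowski S S = mnorm S ^+ 2.
  by rewrite sqr_sqrtr// ltW// minkowski_sum_gt0.
by field; rewrite gt_eqF.
Qed.

(** The tangent vectors (sinh t_i) v_i add up to the projection of S onto the
    tangent plane at P, whatever unit directions are chosen at the points
    x_i = P. *)
Lemma sum_sinh_direction (P : 'rV[R]_3) (v : 'I_r -> 'rV[R]_3) :
  hyperboloid P -> (forall i, unit_direction P (x i) (v i)) ->
  \sum_(i < r) sinh (hdist P (x i)) *: v i = S - minkowski P S *: P.
Proof.
move=> hP hv; rewrite minkowski_sumr scaler_suml -sumrB.
apply: eq_bigr => i _; rewrite -cosh_hdist//.
by case: (hv i) => _ _ {2}->; rewrite addrC addKr.
Qed.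

(** If S = c P with c > 0, then M(S, S) = c^2, so c is the norm of S. *)
Lemma hyperbolic_center_colinear (P : 'rV[R]_3) (c : R) :
  hyperboloid P -> 0 < c -> S = c *: P -> hyperbolic_center x = P.
Proof.
move=> [PP _] c0 SE; rewrite /hyperbolic_center -/S SE.
rewrite /mnorm minkowskiZr minkowskiC minkowskiZr PP mulr1 -expr2.
by rewrite sqrtr_sqr gtr0_norm// scalerA mulVf ?scale1r// gt_eqF.
Qed.

End SumOfPoints.

Theorem proposition4 (R : realType) (r : nat) (hr : (1 <= r)%N)
    (x : 'I_r -> 'rV[R]_3) (hx : forall i, hyperboloid (x i)) :
  unique
    (fun P : 'rV[R]_3 =>
       hyperboloid P /\
       exists v : 'I_r -> 'rV[R]_3,
         (forall i, unit_direction P (x i) (v i)) /\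
         \sum_(i < r) sinh (hdist P (x i)) *: v i = 0)
    (hyperbolic_center x).
Proof.
have hC := hyperboloid_center _ _ _ hr hx; split.
  split=> //.
  have /choice[v hv] i := unit_direction_exists hC (hx i).
  exists v; split=> //; rewrite (sum_sinh_direction _ _ _ hx)//.
  (* With C the center, S = ||S|| C and M(C, C) = 1 give M(C, S) = ||S||. *)
  have SE := sum_hyperbolic_center _ _ _ hr hx.
  by rewrite {2}SE minkowskiZr hC.1 mulr1 -SE subrr.
move=> P [hP [v [hv]]].
rewrite (sum_sinh_direction _ _ _ hx)// => /subr0_eq SE.
apply: hyperbolic_center_colinear SE => //.
exact: minkowski_hyperboloid_sum_gt0.
Qed.
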